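(* Let $n \in \mathbb{N}$, $n \geq 2$, and let $\mathfrak{F}_{n}$ be the uniform block bijection monoid of degree $n$. Then the maximal subsemigroups of $\mathfrak{F}_{n}$ are precisely: (a) $(\mathfrak{F}_{n} \setminus \mathcal{S}_{n}) \cup U$, where $U$ is a maximal subgroup of $\mathcal{S}_{n}$ (type (M5)); and (b) $\mathfrak{F}_{n} \setminus \{\alpha \in \mathfrak{F}_{n} : \operatorname{rank}(\alpha) = n - 1\}$ (type (M1)). In particular, for $n \geq 2$, there are $s_{n} + 1$ maximal subsemigroups of $\mathfrak{F}_{n}$, where $s_{n}$ is the number of maximal subgroups of the symmetric group of degree $n$.
   Context: $\mathbb{N}=\{1,2,3,\ldots\}$. A maximal subsemigroup of a semigroup $S$ (maximal subgroup of a group) is a proper subsemigroup (subgroup) not contained in any other proper one. A partition of degree $n$ is an equivalence relation on $\{1,\ldots,n\}\cup\{1',\ldots,n'\}$; its classes are called blocks; a block is transverse if it contains both unprimed and primed points. The rank of a partition is its number of transverse blocks. A block bijection is a partition all of whose blocks are transverse; it is uniform if each of its blocks contains an equal number of points of $\{1,\ldots,n\}$ and of $\{1',\ldots,n'\}$. The product $\alpha\beta$: replace each $i'$ by $i''$ in $\alpha$ to get $\alpha'$, replace each $i$ by $i''$ in $\beta$ to get $\beta'$; let $(\alpha\beta)'$ be the smallest equivalence on $\{1,\ldots,n\}\cup\{1',\ldots,n'\}\cup\{1'',\ldots,n''\}$ containing $\alpha'\cup\beta'$; then $\alpha\beta$ is the restriction of $(\alpha\beta)'$ to $\{1,\ldots,n\}\cup\{1',\ldots,n'\}$.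 $\mathfrak{F}_n$ is the monoid, under this product, of uniform block bijections of degree $n$. $\mathcal{S}_n$ denotes its group of units: the partitions all of whose blocks have the form $\{i,j'\}$, a copy of the symmetric group of degree $n$. Types: a maximal subsemigroup $M$ of a finite monoid $S$ arises from the $\mathscr{J}$-class $J$ if $S\setminus M\subseteq J$; when $J$ is regular, $M$ has type (M1) if $M\cap J=\varnothing$, and (M5) if $M\cap J$ meets every $\mathscr{H}$-class of $J$. *)

(* Defs.v *)
From HB Require Import structures.
From mathcomp Require Import all_boot all_fingroup.

Set Implicit Arguments.
Unset Strict Implicit.
Unset Printing Implicit Defensive.

Local Open Scope group_scope.

(* [inl i] is the unprimed point i and [inr i] is the primed point i';
   indices run over {0, ..., n - 1}. *)
Notation point n := ('I_n + 'I_n)%type.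

Definition is_equivalence (T : finType) (r : {set T * T}) : bool :=
  [&& [forall x, (x, x) \in r],
      [forall x, forall y, ((x, y) \in r) ==> ((y, x) \in r)]
    & [forall x, forall y, forall z,
        ((x, y) \in r) ==> ((y, z) \in r) ==> ((x, z) \in r)]].

Lemma is_equivalenceP (T : finType) (r : {set T * T}) :
  reflect [/\ forall x, (x, x) \in r,
              forall x y, (x, y) \in r -> (y, x) \in r
            & forall x y z, (x, y) \in r -> (y, z) \in r -> (x, z) \in r]
          (is_equivalence r).
Proof.
apply: (iffP and3P) => [] [rr rs rt]; split.
- exact/forallP.
- by move=> x y; apply/implyP/(forallP (forallP rs x)).
- move=> x y z xy yz; move/forallP: rt => /(_ x) /forallP /(_ y) /forallP /(_ z).
  by rewrite xy yz.
- exact/forallP.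
- by apply/forallP=> x; apply/forallP=> y; apply/implyP; apply: rs.
- apply/forallP=> x; apply/forallP=> y; apply/forallP=> z.
  by apply/implyP=> xy; apply/implyP; apply: rt xy.
Qed.

(* A partition of degree n, given by the graph of the equivalence relation. *)
Record bipartition (n : nat) := Bipartition {
  brel :> {set point n * point n};
  _ : is_equivalence brel
}.
HB.instance Definition _ n := [isSub of bipartition n for @brel n].
HB.instance Definition _ n := [Finite of bipartition n by <:].

Section Bipartition.

Variable n : nat.
Implicit Types (a b c : bipartition n) (B : {set point n}) (u v w : {set 'I_n}).

Definition blocks a : {set {set point n}} :=
  equivalence_partition (fun x y => (x, y) \in brel a) [set: point n].

Definition unprimed B : {set 'I_n} := [set i | inl i \in B].
Definition primed B : {set 'I_n} := [set i | inr i \in B].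

Definition transverse B : bool := (unprimed B != set0) && (primed B != set0).

Definition prank a : nat := #|[set B in blocks a | transverse B]|.

Definition block_bijection a : bool := [forall B in blocks a, transverse B].

Definition uniform_block_bijection a : bool :=
  block_bijection a && [forall B in blocks a, #|unprimed B| == #|primed B|].

(* The points of the product graph: [inl x] is the point x of {i} U {i'},
   and [inr i] is the doubly primed point i''. *)
Local Notation stack_point := (point n + 'I_n)%type.

(* i' |-> i'' *)
Definition upper (x : point n) : stack_point :=
  match x with inl i => inl (inl i) | inr i => inr i end.

(* i |-> i'' *)
Definition lower (x : point n) : stack_point :=
  match x with inl i => inr i | inr i => inl (inr i) end.

Definition stack a b : {set stack_point * stack_point} :=
  [set (upper p.1, upper p.2) | p in brel a]
    :|: [set (lower p.1, lower p.2) | p in brel b].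

Definition stack_equiv a b : {set stack_point * stack_point} :=
  [set p | connect (fun x y => (x, y) \in stack a b) p.1 p.2].

Lemma brel_refl a x : (x, x) \in brel a.
Proof. by case/is_equivalenceP: (valP a). Qed.

Lemma brel_sym a x y : ((x, y) \in brel a) = ((y, x) \in brel a).
Proof.
by case/is_equivalenceP: (valP a) => _ s _; apply/idP/idP; apply: s.
Qed.

Lemma brel_trans a x y z :
  (x, y) \in brel a -> (y, z) \in brel a -> (x, z) \in brel a.
Proof. by case/is_equivalenceP: (valP a) => _ _; apply. Qed.

Lemma stack_sym a b x y : ((x, y) \in stack a b) = ((y, x) \in stack a b).
Proof.
suff s z t : (z, t) \in stack a b -> (t, z) \in stack a b by apply/idP/idP; apply: s.
rewrite !inE; case/orP=> /imsetP[[p q] pq [-> ->]]; rewrite brel_sym in pq.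
  by apply/orP; left; apply/imsetP; exists (q, p).
by apply/orP; right; apply/imsetP; exists (q, p).
Qed.

Lemma stack_equiv_equivalence a b : is_equivalence (stack_equiv a b).
Proof.
apply/is_equivalenceP; split=> [x|x y|x y z]; rewrite !inE.
- exact: connect0.
- by rewrite (@sym_connect_sym _ (fun x y => (x, y) \in stack a b)) // => s t;
    apply: stack_sym.
- exact: connect_trans.
Qed.

(* [stack_equiv a b] is the smallest equivalence containing [stack a b]. *)
Lemma stack_equiv_least a b (r : {set stack_point * stack_point}) :
  is_equivalence r -> (stack a b \subset r) = (stack_equiv a b \subset r).
Proof.
case/is_equivalenceP=> rr _ rt; apply/subsetP/subsetP=> sub [x y]; last first.
  by move=> xy; apply: sub; rewrite inE connect1.
rewrite inE => /connectP[p /= + ->]; elim: p x => //= z p IH x /andP[/sub xz zp].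
by apply: rt xz _; apply: IH.
Qed.

Definition mul_rel a b : {set point n * point n} :=
  [set p | (inl p.1, inl p.2) \in stack_equiv a b].

Lemma mul_rel_equivalence a b : is_equivalence (mul_rel a b).
Proof.
case/is_equivalenceP: (stack_equiv_equivalence a b) => r s t.
apply/is_equivalenceP; split=> [x|x y|x y z]; rewrite ![_ \in mul_rel _ _]inE.
- exact: r.
- exact: s.
- exact: t.
Qed.

Definition bmul a b : bipartition n := Bipartition (mul_rel_equivalence a b).

Definition point_index (x : point n) : 'I_n := match x with inl i | inr i => i end.

Definition one_rel : {set point n * point n} :=
  [set p | point_index p.1 == point_index p.2].

Lemma one_rel_equivalence : is_equivalence one_rel.
Proof.
apply/is_equivalenceP; split=> [x|x y|x y z]; rewrite !inE //.
- by rewrite eq_sym.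
- by move=> /eqP-> /eqP->.
Qed.

Definition bone : bipartition n := Bipartition one_rel_equivalence.

(* Monoid laws. A partition is determined by the pairs (u, v) for which u
   together with v' is a union of blocks, and the product of partitions
   corresponds to the composition of the relations formed by these pairs. *)
Definition mem2 u v (x : point n) : bool :=
  match x with inl i => i \in u | inr i => i \in v end.

Definition saturated a u v : Prop :=
  forall x y, (x, y) \in brel a -> mem2 u v x = mem2 u v y.

Lemma saturated_class a x :
  saturated a [set i | (x, inl i) \in brel a] [set i | (x, inr i) \in brel a].
Proof.
move=> y z yz; have E t : mem2 [set i | (x, inl i) \in brel a]
    [set i | (x, inr i) \in brel a] t = ((x, t) \in brel a).
  by case: t => i /=; rewrite inE.
rewrite !E; apply/idP/idP => xt; apply: brel_trans xt _ => //.
by rewrite brel_sym.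
Qed.

Lemma saturated_inj a b :
  (forall u v, saturated a u v <-> saturated b u v) -> a = b.
Proof.
have sub c d : (forall u v, saturated d u v -> saturated c u v) ->
    forall x y, (x, y) \in brel c -> (x, y) \in brel d.
  move=> H x y /(H _ _ (@saturated_class d x)).
  have E t : mem2 [set i | (x, inl i) \in brel d]
      [set i | (x, inr i) \in brel d] t = ((x, t) \in brel d).
    by case: t => i /=; rewrite inE.
  by rewrite !E brel_refl => <-.
move=> H; apply/val_inj/setP => -[x y]; apply/idP/idP; apply: sub => u v /H //.
Qed.

Lemma saturated_mul a b u w :
  saturated (bmul a b) u w <-> exists v, saturated a u v /\ saturated b v w.
Proof.
split=> [sat|[v [sa sb]] x y].
  pose v := [set k | [exists p, mem2 u w p && ((inl p, inr k) \in stack_equiv a b)]].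
  pose f (z : stack_point) := match z with inl p => mem2 u w p | inr k => k \in v end.
  case/is_equivalenceP: (stack_equiv_equivalence a b) => er es et.
  have fE z : f z = [exists p, mem2 u w p && ((inl p, z) \in stack_equiv a b)].
    case: z => [p|k] /=; last by rewrite inE.
    apply/idP/existsP=> [up|[q /andP[uq qp]]]; first by exists p; rewrite up er.
    by rewrite -(sat q p) // inE.
  have fS z t : (z, t) \in stack_equiv a b -> f z = f t.
    move=> zt; rewrite !fE; apply/existsP/existsP=> -[p /andP[up pz]];
      exists p; rewrite up /=; apply: et pz _ => //; exact: es.
  exists v; split=> x y xy.
    suff: f (upper x) = f (upper y) by case: (x) (y) => [?|?] [?|?].
    apply: fS; rewrite inE connect1 // inE; apply/orP; left.
    by apply/imsetP; exists (x, y).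
  suff: f (lower x) = f (lower y) by case: (x) (y) => [?|?] [?|?].
  apply: fS; rewrite inE connect1 // inE; apply/orP; right.
  by apply/imsetP; exists (x, y).
rewrite !inE /= => xy.
pose f (z : stack_point) := match z with inl p => mem2 u w p | inr k => k \in v end.
suff cl : closed (fun x y => (x, y) \in stack a b) f by apply: (closed_connect cl xy).
move=> z t; rewrite inE; case/orP=> /imsetP[[p q] /= pq [-> ->]].
  by move: (sa _ _ pq); case: (p) (q) => [?|?] [?|?].
by move: (sb _ _ pq); case: (p) (q) => [?|?] [?|?].
Qed.

Lemma saturated_one u v : saturated bone u v <-> u = v.
Proof.
split=> [sat|-> x y]; last by rewrite inE; case: x y => [i|i] [j|j] /= /eqP->.
by apply/setP=> i; apply: (sat (inl i) (inr i)); rewrite inE.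
Qed.

Fact bmulA : associative bmul.
Proof.
move=> a b c; apply: saturated_inj => u v; split.
  case/saturated_mul=> s [sa /saturated_mul[t [sb sc]]].
  by apply/saturated_mul; exists t; split=> //; apply/saturated_mul; exists s.
case/saturated_mul=> t [/saturated_mul[s [sa sb]] sc].
by apply/saturated_mul; exists s; split=> //; apply/saturated_mul; exists t.
Qed.

Fact bmul1 : left_id bone bmul.
Proof.
move=> a; apply: saturated_inj => u v.
apply: (iff_trans (saturated_mul _ _ _ _)); split=> [[s [/saturated_one-> sat]] //|sat]; exists u; split=> //.
exact/saturated_one.
Qed.

Fact bmulr1 : right_id bone bmul.
Proof.
move=> a; apply: saturated_inj => u v.
apply: (iff_trans (saturated_mul _ _ _ _)); split=> [[s [sat /saturated_one<-]] //|sat]; exists v; split=> //.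
exact/saturated_one.
Qed.

End Bipartition.

HB.instance Definition _ n :=
  isMonoid.Build (bipartition n) (@bmulA n) (@bmul1 n) (@bmulr1 n).

Section UniformClosed.

Variable n : nat.
Implicit Types a : bipartition n.

Lemma uniform_block_bijectionP a :
  uniform_block_bijection a <-> forall u v, saturated a u v -> #|u| = #|v|.
Proof.
pose cls x := [set y in [set: point n] | (x, y) \in brel a].
have clsB x : cls x \in blocks a by apply: imset_f.
have clsE x y : (y \in cls x) = ((x, y) \in brel a) by rewrite !inE.
have in_cls x B : B \in blocks a -> (cls x == B) = (x \in B).
  case/imsetP=> y _ ->; rewrite -/(cls y); apply/eqP/idP => [<-|].
    by rewrite clsE brel_refl.
  rewrite clsE => yx; apply/setP=> z; rewrite !clsE.
  apply/idP/idP; apply: brel_trans => //; by rewrite brel_sym.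
split=> [/andP[_ /forall_inP unif] u v sat|unif].
  have count (g : 'I_n -> point n) (s : {set 'I_n}) :
      (forall i, (i \in s) = mem2 u v (g i)) ->
      #|s| = (\sum_(B in blocks a | [forall x in B, mem2 u v x])
               #|[set i | g i \in B]|)%N.
    move=> gs; rewrite -sum1_card.
    rewrite (partition_big (fun i => cls (g i))
      (fun B => (B \in blocks a) && [forall x in B, mem2 u v x])) /=; last first.
      move=> i; rewrite gs => si; rewrite clsB /=; apply/forall_inP=> x.
      by rewrite clsE => /sat <-.
    apply: eq_bigr => B /andP[aB /forall_inP sB]; rewrite sum1dep_card.
    apply: eq_card => i; rewrite !inE in_cls // gs andbC.
    by case: (boolP (g i \in B)) => //= /sB.
  rewrite (count inl u) ?(count inr v) //.
  by apply: eq_bigr => B /andP[/unif/eqP].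
have eqB B : B \in blocks a -> #|unprimed B| = #|primed B|.
  case/imsetP=> x _ ->; rewrite -/(cls x).
  have -> : unprimed (cls x) = [set i | (x, inl i) \in brel a].
    by apply/setP=> i; rewrite !inE.
  have -> : primed (cls x) = [set i | (x, inr i) \in brel a].
    by apply/setP=> i; rewrite !inE.
  exact/unif/saturated_class.
apply/andP; split; apply/forall_inP=> B aB; last by rewrite eqB.
rewrite /transverse -!card_gt0 eqB // andbb.
case/imsetP: (aB) => x _; rewrite -/(cls x) => defB.
have: x \in B by rewrite defB clsE brel_refl.
case: x {defB} => i Bi; last by apply/card_gt0P; exists i; rewrite inE.
by rewrite -eqB //; apply/card_gt0P; exists i; rewrite inE.
Qed.

Fact uniform_block_bijection_closed :
  monoid_closed (@uniform_block_bijection n).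
Proof.
split=> [|a b /uniform_block_bijectionP ua /uniform_block_bijectionP ub];
  apply/uniform_block_bijectionP=> u w.
  by move/saturated_one->.
by case/saturated_mul=> v [/ua-> /ub].
Qed.

End UniformClosed.

Record ubb (n : nat) := UBB {
  bipartition_of_ubb :> bipartition n;
  _ : uniform_block_bijection bipartition_of_ubb
}.
HB.instance Definition _ n := [isSub of ubb n for @bipartition_of_ubb n].
HB.instance Definition _ n := [Finite of ubb n by <:].
HB.instance Definition _ n :=
  SubChoice_isSubMonoid.Build (bipartition n) (@uniform_block_bijection n)
    (ubb n) (@uniform_block_bijection_closed n).

Section MaximalSubsemigroups.

Variable n : nat.
Local Notation S := (ubb n).
Implicit Types (x y : S) (M U J : {set S}).

(* S_n, the group of units. *)
Definition perm_units : {set S} :=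
  [set x : S | [forall B in blocks x, exists i, exists j, B == [set inl i; inr j]]].

Definition subsemigroup M : bool :=
  (M != set0) && [forall x in M, forall y in M, x * y \in M].

Definition maximal_subsemigroup M : bool :=
  maxset (fun A => subsemigroup A && (A \proper [set: S])) M.

Definition subgroup_of_units U : bool :=
  [&& U \subset perm_units, 1 \in U,
      [forall x in U, forall y in U, x * y \in U]
    & [forall x in U, exists y in U, (x * y == 1) && (y * x == 1)]].

Definition maximal_subgroup_of_units U : bool :=
  maxset (fun V => subgroup_of_units V && (V \proper perm_units)) U.

Definition left_ideal x : {set S} := [set s * x | s : S].
Definition right_ideal x : {set S} := [set x * s | s : S].
Definition ideal x : {set S} := [set s * x * t | s : S, t : S].

Definition greenL : rel S := fun x y => left_ideal x == left_ideal y.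
Definition greenR : rel S := fun x y => right_ideal x == right_ideal y.
Definition greenH : rel S := fun x y => greenL x y && greenR x y.
Definition greenJ : rel S := fun x y => ideal x == ideal y.

Definition Hclasses : {set {set S}} := equivalence_partition greenH [set: S].
Definition Jclasses : {set {set S}} := equivalence_partition greenJ [set: S].

Definition regular_class J : bool := [forall x in J, exists y, x * y * x == x].

Definition arises_from M J : bool :=
  [&& maximal_subsemigroup M, J \in Jclasses & ~: M \subset J].

Definition type_M1 M : bool :=
  [exists J, [&& arises_from M J, regular_class J & M :&: J == set0]].

Definition type_M5 M : bool :=
  [exists J, [&& arises_from M J, regular_class J
    & [forall H in Hclasses, (H \subset J) ==> (M :&: J :&: H != set0)]]].

End MaximalSubsemigroups.

Arguments perm_units n : clear implicits.

(* Main.v *)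
Require Import Defs.
From mathcomp Require Import all_boot all_fingroup all_solvable.

(** Write P for the group of units of the monoid F of uniform block bijections
    and J for its elements of rank n - 1.

    Every x in F is a product of a unit and an idempotent: since each block
    meets the two rows in equally many points, there is a permutation s such
    that i and (s i)' always lie in a common block ([transversal_perm]), and
    then x is the unit of s followed by the idempotent whose kernel is the
    restriction of x to the primed row ([ubb_factor]). Such an idempotent is
    the product of the idempotents [merge_pair i j], which join just i to j,
    over the pairs (i, j) that it identifies ([idem_prod]). The rank does not
    increase under multiplication on either side; the elements of rank n are
    the units, and an element of rank n - 1 is a unit times some
    [merge_pair i j] with i != j ([prank_pred]). All the [merge_pair i j] with
    i != j are conjugate under P, so P x P = J for each x in J
    ([prank_pred_transitive]), and hence P and any single element of J generate
    F ([generation]).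

    Let M be a maximal subsemigroup. If M contains P, it is disjoint from J by
    [generation], so it equals the complement of J, which is a subsemigroup.
    Otherwise, as F \ P is an ideal, M together with F \ P is a proper
    subsemigroup, so M contains F \ P; and 1 is in M, because otherwise M would
    be F without 1, which contains a transposition but not its square. So M is
    F \ P together with a subgroup of P, which has to be maximal
    ([maximal_subsemigroup_cases]). The converses, [maximal_extension] and
    [maximal_corank1], follow from the same facts, and the count holds because
    the subgroup is recovered from M as its set of units. *)

Set Implicit Arguments.
Unset Strict Implicit.
Unset Printing Implicit Defensive.

Local Open Scope group_scope.

(** * Kernels of labellings of the points *)

Section Kernel.

Variables (n : nat) (T : finType) (f : point n -> T).

Definition kernel_rel : {set point n * point n} := [set p | f p.1 == f p.2].

Lemma kernel_rel_equivalence : is_equivalence kernel_rel.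
Proof.
apply/is_equivalenceP; split=> [x|x y|x y z]; rewrite !inE //.
- by rewrite eq_sym.
- by move=> /eqP-> /eqP->.
Qed.

(** The partition in which two points lie in the same block exactly when f
    gives them the same label. *)
Definition kernel : bipartition n := Bipartition kernel_rel_equivalence.

Lemma kernelE x y : ((x, y) \in brel kernel) = (f x == f y).
Proof. by rewrite inE. Qed.

End Kernel.

(** * Factorization into a unit and idempotents *)

Section Factorization.

Variable n : nat.
Implicit Types (a b : bipartition n) (x y : ubb n) (s t : 'S_n).

(** The labelling whose kernel has the blocks {i, (s i)'}: each block is
    labelled by the index of its primed point. *)
Definition perm_target s (p : point n) : 'I_n :=
  match p with inl i => s i | inr i => i end.

(** By [saturated_inj] and [saturated_mul], partitions can be compared and
    multiplied through their saturated pairs, that is, the pairs (u, v) such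
    that u together with v' is a union of blocks. *)
Lemma saturated_perm s (u v : {set 'I_n}) :
  saturated (kernel (perm_target s)) u v <-> u = s @^-1: v.
Proof.
split=> [sat|-> p q].
  apply/setP=> i; rewrite inE.
  by apply: (sat (inl i) (inr (s i))); rewrite kernelE.
by rewrite kernelE; case: p q => i [] j /= /eqP E; rewrite ?inE ?E // -E.
Qed.

Lemma perm_unit_uniform s : uniform_block_bijection (kernel (perm_target s)).
Proof.
apply/uniform_block_bijectionP=> u v /saturated_perm->.
by rewrite on_card_preimset //; exists (perm_inv s) => i _; rewrite ?permK ?permKV.
Qed.

(** The unit of F with blocks {i, (s i)'}. *)
Definition perm_unit s : ubb n := UBB (perm_unit_uniform s).

(** The labelling that gives i and i' the same label g i. *)
Definition idem_map (T : finType) (g : 'I_n -> T) (p : point n) : T :=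
  g (point_index p).

Lemma saturated_idem (T : finType) (g : 'I_n -> T) (u v : {set 'I_n}) :
  saturated (kernel (idem_map g)) u v
    <-> u = v /\ forall i j, g i = g j -> (i \in v) = (j \in v).
Proof.
split=> [sat|[-> sat] p q]; last first.
  by rewrite kernelE; case: p q => i [] j /= /eqP /sat.
have uv : u = v.
  by apply/setP=> i; apply: (sat (inl i) (inr i)); rewrite kernelE.
split=> // i j gij; apply: (sat (inr i) (inr j)).
by rewrite kernelE /idem_map /= gij.
Qed.

Lemma idem_uniform (T : finType) (g : 'I_n -> T) :
  uniform_block_bijection (kernel (idem_map g)).
Proof. by apply/uniform_block_bijectionP=> u v /saturated_idem[->]. Qed.

(** The idempotent with a block A together with A' for each fibre A of g. *)
Definition idem (T : finType) (g : 'I_n -> T) : ubb n := UBB (idem_uniform g).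

Lemma ubb_saturated_inj x y :
  (forall u v, saturated x u v <-> saturated y u v) -> x = y.
Proof. by move=> H; apply/val_inj/saturated_inj. Qed.

Lemma ubb_saturated_mul x y (u w : {set 'I_n}) :
  saturated (x * y) u w <-> exists v, saturated x u v /\ saturated y v w.
Proof. exact: saturated_mul. Qed.

Lemma ubb_saturated1 (u v : {set 'I_n}) :
  saturated (1 : ubb n) u v <-> u = v.
Proof. exact: saturated_one. Qed.

Lemma saturated_perm_mul s x (u w : {set 'I_n}) :
  saturated (perm_unit s * x) u w
    <-> exists v : {set 'I_n}, u = s @^-1: v /\ saturated x v w.
Proof.
split; first by case/ubb_saturated_mul=> v [/saturated_perm ? ?]; exists v.
by case=> v [/saturated_perm ? ?]; apply/ubb_saturated_mul; exists v.
Qed.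

Lemma perm_unit1 : perm_unit 1 = 1.
Proof.
apply: ubb_saturated_inj => u v.
have E : (1 : 'S_n) @^-1: v = v by apply/setP=> i; rewrite inE perm1.
by split=> [/saturated_perm->|/ubb_saturated1->];
  [apply/ubb_saturated1 | apply/saturated_perm]; rewrite E.
Qed.

Lemma perm_unitM : {morph perm_unit : s t / s * t}.
Proof.
move=> s t; apply: ubb_saturated_inj => u v.
have E : (s * t) @^-1: v = s @^-1: (t @^-1: v).
  by apply/setP=> i; rewrite !inE permM.
split=> [/saturated_perm->|/saturated_perm_mul[w [-> /saturated_perm->]]].
  apply/saturated_perm_mul; exists (t @^-1: v); split=> //.
  exact/saturated_perm.
exact/saturated_perm.
Qed.

Lemma perm_unitVK s : perm_unit s^-1 * perm_unit s = 1.
Proof. by rewrite -perm_unitM mulVg perm_unit1. Qed.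

Lemma perm_unitKV s : perm_unit s * perm_unit s^-1 = 1.
Proof. by rewrite -perm_unitM mulgV perm_unit1. Qed.

Lemma perm_unit_inj : injective perm_unit.
Proof.
move=> s t st; apply/permP=> i; apply/esym/eqP.
have: (inl i, inr (s i)) \in brel (perm_unit t) by rewrite -st kernelE.
by rewrite kernelE.
Qed.

(** The block of p. *)
Definition class_of a (p : point n) : {set point n} :=
  [set q in [set: point n] | (p, q) \in brel a].

Lemma class_ofE a p q : (class_of a p == class_of a q) = ((p, q) \in brel a).
Proof.
apply/eqP/idP => [/setP/(_ q)|pq]; first by rewrite !inE brel_refl.
apply/setP=> r; rewrite !inE /=.
by apply/idP/idP; apply: brel_trans; rewrite // brel_sym.
Qed.

(** The list of the blocks of the unprimed points and that of the primed points
    contain each block equally often, by uniformity, so they are permutations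
    of each other. *)
Lemma transversal_perm x : exists s, forall i, (inl i, inr (s i)) \in brel x.
Proof.
pose tl := [tuple class_of x (inl i) | i < n].
pose tr := [tuple class_of x (inr i) | i < n].
have count_cls (g : 'I_n -> point n) p :
    count_mem (class_of x p) [tuple class_of x (g i) | i < n]
      = #|[set i | (p, g i) \in brel x]|.
  rewrite count_map -sum1_count -sum1_card big_enum_cond /=.
  by apply: eq_bigl => i; rewrite !inE eq_sym class_ofE.
have /tuple_permP[s E] : perm_eq tl tr.
  apply/allP=> B; rewrite mem_cat => BP.
  have [p ->] : exists p, B = class_of x p.
    by case/orP: BP => /mapP[i _ ->]; [exists (inl i) | exists (inr i)].
  rewrite /= !count_cls; apply/eqP.
  by move/uniform_block_bijectionP: (valP x); apply; apply: saturated_class.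
exists s => i; rewrite -class_ofE; apply/eqP.
by move/val_inj/(congr1 (fun r => tnth r i)): E; rewrite !tnth_mktuple.
Qed.

Lemma ubb_factor x s (T : finType) (g : 'I_n -> T) :
    (forall i, (inl i, inr (s i)) \in brel x) ->
    (forall i j, (g i == g j) = ((inr i, inr j) \in brel x)) ->
  x = perm_unit s * idem g.
Proof.
move=> xs xg; apply: ubb_saturated_inj => u v; split=> [sat|].
  apply/saturated_perm_mul; exists v; split.
    by apply/setP=> i; rewrite inE; apply: (sat (inl i) (inr (s i))).
  apply/saturated_idem; split=> // i j /eqP; rewrite xg.
  exact: (sat (inr i) (inr j)).
case/saturated_perm_mul=> w [-> /saturated_idem[-> sat]].
(* The index [perm_target s p] is that of a primed point of the block of p. *)
have memE p : Defs.mem2 (s @^-1: v) v p = (perm_target s p \in v).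
  by case: p => i //=; rewrite inE.
have toR p : (p, inr (perm_target s p)) \in brel x.
  by case: p => i /=; rewrite ?brel_refl.
move=> p q pq; rewrite !memE; apply/sat/eqP; rewrite xg.
apply: brel_trans (toR q); apply: brel_trans pq.
by rewrite brel_sym.
Qed.

Lemma ubb_factorization x :
  exists s, x = perm_unit s * idem (fun i => class_of x (inr i)).
Proof.
have [s xs] := transversal_perm x; exists s.
by apply: ubb_factor => // i j; rewrite class_ofE.
Qed.

Lemma idem_inj1 (T : finType) (g : 'I_n -> T) : injective g -> idem g = 1.
Proof.
move=> gI; apply: ubb_saturated_inj => u v; split.
  by case/saturated_idem=> -> _; apply/ubb_saturated1.
by move/ubb_saturated1->; apply/saturated_idem; split=> // i j /gI->.
Qed.

Lemma idem_idem (T : finType) (g : 'I_n -> T) : idem g * idem g = idem g.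
Proof.
apply: ubb_saturated_inj => u v; split.
  by case/ubb_saturated_mul=> w [/saturated_idem[-> _]].
move=> sat; apply/ubb_saturated_mul; exists u; split=> //.
by move/saturated_idem: sat => [-> sat]; apply/saturated_idem.
Qed.

Lemma eq_idem (T T' : finType) (g : 'I_n -> T) (h : 'I_n -> T') :
  (forall i j, (g i == g j) = (h i == h j)) -> idem g = idem h.
Proof.
move=> gh; apply/val_inj/val_inj/setP=> -[p q].
by rewrite !kernelE /idem_map gh.
Qed.

(** The map that sends j to i and fixes every other index. *)
Definition collapse (i j k : 'I_n) : 'I_n := if k == j then i else k.

(** The idempotent with the block {i, j, i', j'}, all others being of the form
    {k, k'}; it is 1 when i = j. *)
Definition merge_pair i j : ubb n := idem (collapse i j).

Lemma saturated_merge i j (u v : {set 'I_n}) :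
  saturated (merge_pair i j) u v <-> u = v /\ (i \in v) = (j \in v).
Proof.
split=> [/saturated_idem[-> sat]|[-> ij]].
  by split=> //; apply: sat; rewrite /collapse eqxx; case: eqP.
apply/saturated_idem; split=> // k l; rewrite /collapse.
by do 2![case: eqP => [->|_]] => // E; rewrite -?E // ?E.
Qed.

Lemma merge_pair_id i : merge_pair i i = 1.
Proof. by apply: idem_inj1 => k l; rewrite /collapse; do 2![case: eqP => [->|_]]. Qed.

Lemma merge_conj s i j :
  merge_pair i j = perm_unit s * merge_pair (s i) (s j) * perm_unit s^-1.
Proof.
apply: ubb_saturated_inj => u v.
have E : s^-1 @^-1: v = s @: v.
  by apply/setP=> k; rewrite inE -[in RHS](permKV s k) mem_imset //; apply: perm_inj.
have F : s @^-1: (s^-1 @^-1: v) = v.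
  by apply/setP=> k; rewrite !inE permK.
split=> [/saturated_merge[-> ij]|].
  apply/ubb_saturated_mul; exists (s^-1 @^-1: v); split; last exact/saturated_perm.
  apply/saturated_perm_mul; exists (s^-1 @^-1: v); split=> //.
  by apply/saturated_merge; split=> //; rewrite !inE !permK.
case/ubb_saturated_mul=> w [/saturated_perm_mul[w' [->]]].
move=> /saturated_merge[-> ij] /saturated_perm wE.
rewrite {}wE in ij *; rewrite F; apply/saturated_merge; split=> //.
by rewrite !inE !permK in ij.
Qed.

Lemma idem_prod (T : finType) (g : 'I_n -> T) :
  idem g = \prod_(p : 'I_n * 'I_n | g p.1 == g p.2) merge_pair p.1 p.2.
Proof.
rewrite -big_filter; set r := filter _ _.
have rE i j : ((i, j) \in r) = (g i == g j) by rewrite mem_filter mem_index_enum andbT.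
suff satP (l : seq ('I_n * 'I_n)) (u v : {set 'I_n}) :
    saturated (\prod_(p <- l) merge_pair p.1 p.2) u v
      <-> u = v /\ {in l, forall p, (p.1 \in v) = (p.2 \in v)}.
  apply: ubb_saturated_inj => u v; split.
    case/saturated_idem=> -> sat; apply/satP; split=> // -[i j].
    by rewrite rE => /eqP /sat.
  case/satP=> -> sat; apply/saturated_idem; split=> // i j /eqP.
  by rewrite -rE => /sat.
elim: l u => [|p l IH] u.
  rewrite big_nil; split=> [/ubb_saturated1->|[-> _]] //; exact/ubb_saturated1.
rewrite big_cons; split.
  case/ubb_saturated_mul=> w [/saturated_merge[-> pw] /IH[wv sat]].
  rewrite {}wv in pw *; split=> // q; rewrite inE => /predU1P[->|/sat] //.
case=> -> sat; apply/ubb_saturated_mul; exists v; split.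
  by apply/saturated_merge; split=> //; apply: sat; rewrite inE eqxx.
by apply/IH; split=> // q lq; apply: sat; rewrite inE lq orbT.
Qed.

End Factorization.

(** * Rank *)

Lemma card_imset_coarser (I T T' : finType) (f : I -> T) (h : I -> T') :
  (forall i j, f i = f j -> h i = h j) -> #|[set h i | i : I]| <= #|[set f i | i : I]|.
Proof.
(* h factors through f via k, up to the injection of its values as singletons. *)
move=> fh; pose k z := [set h i | i in [set i | f i == z]].
have kE i : k (f i) = [set h i].
  apply/setP=> z; rewrite inE; apply/imsetP/eqP => [[j]|->].
    by rewrite inE => /eqP/fh -> ->.
  by exists i; rewrite // inE.
rewrite -(card_imset _ set1_inj) -imset_comp.
rewrite (eq_imset (g := k \o f)) => [|i /=]; last by rewrite kE.
by rewrite imset_comp leq_imset_card.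
Qed.

Section Rank.

Variable n : nat.
Implicit Types (x y : ubb n) (s t : 'S_n).

Lemma prank_blocks x : prank x = #|blocks x|.
Proof.
have /andP[/forall_inP tr _] := valP x; apply: eq_card => B; rewrite inE.
by case: (boolP (B \in blocks x)) => //= /tr ->.
Qed.

(** Each block contains both an unprimed and a primed point, so the blocks can
    be counted along either row. *)
Lemma prank_kernel x (T : finType) (f : point n -> T) :
    (forall p q, (f p == f q) = ((p, q) \in brel x)) ->
  prank x = #|[set f (inr i) | i : 'I_n]| /\ prank x = #|[set f (inl i) | i : 'I_n]|.
Proof.
move=> fx; have [s xs] := transversal_perm x.
have fs i : f (inl i) = f (inr (s i)) by apply/eqP; rewrite fx.
have fE : [set f p | p : point n] = [set f (inr i) | i : 'I_n].
  apply/setP=> z; apply/imsetP/imsetP => [[[] i _ ->]|[i _ ->]].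
  - by exists (s i); rewrite // fs.
  - by exists i.
  - by exists (inr i).
have fE' : [set f p | p : point n] = [set f (inl i) | i : 'I_n].
  apply/setP=> z; apply/imsetP/imsetP => [[[] i _ ->]|[i _ ->]].
  - by exists i.
  - by exists (s^-1 i); rewrite // fs permKV.
  - by exists (inl i).
rewrite -fE -fE' prank_blocks.
have -> : blocks x = [set class_of x p | p : point n].
  by apply/setP=> B; apply/imsetP/imsetP => -[p _ ->]; exists p.
by split; apply/eqP; rewrite eqn_leq !card_imset_coarser // => p q /eqP;
  rewrite (class_ofE, fx) => ?; apply/eqP; rewrite (class_ofE, fx).
Qed.

(** Comparing the kernels on one of the two rows is enough to compare ranks. *)
Lemma prank_le x y :
    (forall i j, (inl i, inl j) \in brel x -> (inl i, inl j) \in brel y)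
      \/ (forall i j, (inr i, inr j) \in brel x -> (inr i, inr j) \in brel y) ->
  prank y <= prank x.
Proof.
have [xr xl] := prank_kernel (class_ofE x).
have [yr yl] := prank_kernel (class_ofE y).
case=> le; [rewrite xl yl | rewrite xr yr]; apply: card_imset_coarser => i j /eqP;
  by rewrite class_ofE => /le; rewrite -class_ofE => /eqP.
Qed.

Lemma prank_mull x y : prank (x * y) <= prank x.
Proof.
apply: prank_le; left=> i j xij; rewrite inE inE connect1 //= inE.
by apply/orP; left; apply/imsetP; exists (inl i, inl j).
Qed.

Lemma prank_mulr x y : prank (x * y) <= prank y.
Proof.
apply: prank_le; right=> i j yij; rewrite inE inE connect1 //= inE.
by apply/orP; right; apply/imsetP; exists (inr i, inr j).
Qed.

Lemma prank_perm s : prank (perm_unit s) = n.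
Proof.
have [-> _] := @prank_kernel (perm_unit s) _ (perm_target s) (fun p q => esym (kernelE _ p q)).
by rewrite card_imset ?card_ord.
Qed.

Lemma prank1 : prank (1 : ubb n) = n.
Proof. by rewrite -(perm_unit1 n) prank_perm. Qed.

Lemma prank_idem (T : finType) (g : 'I_n -> T) :
  prank (idem g) = #|[set g i | i : 'I_n]|.
Proof.
by have [-> _] := @prank_kernel (idem g) _ (idem_map g)
  (fun p q => esym (kernelE _ p q)).
Qed.

Lemma prank_perm_mul s x : prank (perm_unit s * x) = prank x.
Proof.
apply/eqP; rewrite eqn_leq prank_mulr /=.
by rewrite -{1}[x]mul1g -(perm_unitVK s) -mulgA prank_mulr.
Qed.

Lemma prank_max x : prank x <= n.
Proof. by rewrite -[x]mul1g (leq_trans (prank_mull _ _)) ?prank1. Qed.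

Lemma prank_merge (i j : 'I_n) : i != j -> prank (merge_pair i j) = n.-1.
Proof.
move=> ij; rewrite prank_idem.
have -> : [set collapse i j k | k : 'I_n] = [set~ j].
  apply/setP=> k; rewrite !inE; apply/imsetP/idP => [[l _ ->]|kj].
    by rewrite /collapse; case: (l =P j) => // /eqP.
  by exists k; rewrite // /collapse (negPf kj).
by rewrite cardsC1 card_ord.
Qed.

Lemma prank_pred x : 0 < n -> prank x = n.-1 ->
  exists s (i j : 'I_n), i != j /\ x = perm_unit s * merge_pair i j.
Proof.
move=> n_gt0; have [s ->] := ubb_factorization x.
rewrite prank_perm_mul prank_idem; set g := fun i => _ => cg.
have /injectivePn[j [i ij gij]] : ~~ injectiveb g.
  apply: contraL (n_gt0) => /injectiveP gI; rewrite -leqNgt.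
  by move: cg; rewrite card_imset // card_ord; case: (n) => //= m /eqP; rewrite eqn_leq ltnn.
exists s, i, j; split; first by rewrite eq_sym.
congr (_ * _); apply: eq_idem.
(* g has the same image on the complement of j as everywhere, so by counting it
   is injective there: i and j are the only indices that it identifies. *)
have gc k : g (collapse i j k) = g k by rewrite /collapse; case: eqP => [->|].
have cj k : collapse i j k \in [set~ j].
  by rewrite !inE /collapse; case: (k =P j) => [_|/eqP] //; rewrite eq_sym.
have /imset_injP gI : #|g @: [set~ j]| == #|[set~ j]|.
  rewrite cardsC1 card_ord -cg; apply/eqP/eq_card => z.
  apply/imsetP/imsetP => -[k _ ->]; first by exists k.
  by exists (collapse i j k); rewrite // gc.
move=> k l; apply/eqP/eqP => [|E]; last by rewrite -gc E gc.
by rewrite -gc -[g l]gc => /gI; apply.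
Qed.

Lemma prank_full x : prank x = n -> exists s, x = perm_unit s.
Proof.
have [s ->] := ubb_factorization x; rewrite prank_perm_mul prank_idem => cg.
have /imset_injP gI := introT eqP (etrans cg (esym (card_ord n))).
by exists s; rewrite idem_inj1 ?mulg1 // => i j; apply: gI.
Qed.

Lemma perm_unitsP x : reflect (exists s, x = perm_unit s) (x \in perm_units n).
Proof.
rewrite inE; apply: (iffP forall_inP) => [pb|[s ->] B].
  have [s xs] := transversal_perm x; exists s; apply/val_inj/val_inj/setP=> -[p q].
  have clE i : class_of x (inl i) = [set inl i; inr (s i)].
    have /pb/existsP[k /existsP[l /eqP E]] : class_of x (inl i) \in blocks x.
      exact: imset_f.
    have : inl i \in class_of x (inl i) by rewrite !inE brel_refl.
    have : inr (s i) \in class_of x (inl i) by rewrite !inE xs.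
    by rewrite E !inE /= => /eqP[->] /orP[/eqP[->]|].
  have toL r : (r, inl (s^-1 (perm_target s r))) \in brel x.
    case: r => i /=; rewrite ?permK ?brel_refl // brel_sym.
    by have := xs (s^-1 i); rewrite permKV.
  (* Replace p and q by unprimed points of the same blocks. *)
  have -> : (p, q) \in brel x =
      ((inl (s^-1 (perm_target s p)), inl (s^-1 (perm_target s q))) \in brel x).
    rewrite -!class_ofE; congr (_ == _); apply/eqP; rewrite class_ofE; exact: toL.
  rewrite kernelE -class_ofE !clE; apply/eqP/eqP => [/setP|->] //.
  move/(_ (inl (s^-1 (perm_target s p)))).
  by rewrite !inE eqxx /= orbF => /esym/eqP[/perm_inj].
case/imsetP=> p _ ->; apply/existsP; exists (s^-1 (perm_target s p)).
apply/existsP; exists (perm_target s p); apply/eqP/setP=> -[] i; rewrite !inE /= ?orbF.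
  apply/eqP/eqP => [->|[->]]; by rewrite ?permK ?permKV.
by rewrite eq_sym.
Qed.

Lemma perm_units_prank x : (x \in perm_units n) = (prank x == n).
Proof.
apply/perm_unitsP/eqP => [[s ->]|/prank_full //]; exact: prank_perm.
Qed.

End Rank.

(** * Maximal subsemigroups *)

Section Classification.

Variable n : nat.
Implicit Types (x y : ubb n) (s t : 'S_n) (M N : {set ubb n}) (G H : {group 'S_n}).

Local Notation P := (perm_units n).
Local Notation J := [set x : ubb n | prank x == n.-1].
Local Notation perm_unit := (@perm_unit n).

Lemma mem_perm_unit s : perm_unit s \in P.
Proof. by apply/perm_unitsP; exists s. Qed.

Lemma perm_units1 : 1 \in P.
Proof. by rewrite -(perm_unit1 n) mem_perm_unit. Qed.

Lemma perm_units_mul x y : (x * y \in P) = (x \in P) && (y \in P).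
Proof.
apply/idP/andP => [|[/perm_unitsP[s ->] /perm_unitsP[t ->]]]; last first.
  by rewrite -perm_unitM mem_perm_unit.
rewrite !perm_units_prank => /eqP xy; split; rewrite eqn_leq prank_max /= -[X in X <= _]xy.
  exact: prank_mull.
exact: prank_mulr.
Qed.

Lemma prank_pred_transitive x y : 0 < n -> x \in J -> y \in J ->
  exists s t, y = perm_unit s * x * perm_unit t.
Proof.
rewrite !inE => n_gt0 /eqP/(prank_pred n_gt0)[s [i [j [ij ->]]]].
move=> /eqP/(prank_pred n_gt0)[t [k [l [kl ->]]]].
(* r maps k to i and l to j: after exchanging k and i, the index l has moved to
   l', which differs from i. *)
pose l' := tperm k i l; pose r := tperm k i * tperm l' j.
have rk : r k = i.
  rewrite permM tpermL tpermD // 1?eq_sym //.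
  by rewrite -{1}(tpermL k i) (inj_eq perm_inj).
have rl : r l = j by rewrite permM tpermL.
exists (t * r * s^-1), r^-1; rewrite (merge_conj r k l) rk rl !perm_unitM !mulgA.
by rewrite -(mulgA _ (perm_unit s^-1)) perm_unitVK mulg1.
Qed.

Lemma subsemigroupP M :
  reflect (M != set0 /\ {in M &, forall x y, x * y \in M}) (subsemigroup M).
Proof.
apply: (iffP andP) => -[M0 MM]; split=> //.
  by move=> x y Mx My; move/forall_inP/(_ x Mx)/forall_inP: MM; apply.
by apply/forall_inP=> x Mx; apply/forall_inP=> y My; apply: MM.
Qed.

Lemma maximal_subsemigroupP M :
  reflect [/\ subsemigroup M, M != [set: ubb n]
            & forall N, subsemigroup N -> M \subset N -> N = M \/ N = [set: ubb n]]
          (maximal_subsemigroup M).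
Proof.
apply: (iffP maxsetP) => [[/andP[sM]]|[sM MT maxM]].
  rewrite properT => MT maxM; split=> // N sN MN.
  have [->|NT] := eqVneq N [set: ubb n]; [by right | left].
  by apply: maxM; rewrite // sN properT.
split=> [|N]; first by rewrite sM properT.
by rewrite properT => /andP[sN NT] /(maxM N sN)[|/eqP] // E; rewrite E in NT.
Qed.

Lemma generation M x : 0 < n ->
  subsemigroup M -> P \subset M -> x \in J -> x \in M -> M = [set: ubb n].
Proof.
move=> n_gt0 /subsemigroupP[_ MM] /subsetP PM Jx Mx.
have PuM s : perm_unit s \in M by apply/PM/mem_perm_unit.
have M1 : 1 \in M by apply/PM/perm_units1.
have mergeM i j : merge_pair i j \in M.
  have [<-|ij] := eqVneq i j; first by rewrite merge_pair_id.
  have [|s [t ->]] := prank_pred_transitive (y := merge_pair i j) n_gt0 Jx.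
    by rewrite inE prank_merge.
  by apply: (MM); first apply: MM.
apply/setP=> y; rewrite inE; have [s ->] := ubb_factorization y.
apply: (MM) => //; rewrite idem_prod.
by apply: (big_ind (fun z => z \in M)) => // ? ?; apply: MM.
Qed.

Lemma subsemigroup_corank1 : 0 < n -> subsemigroup (~: J).
Proof.
move=> n_gt0; have n1n : n != n.-1 by rewrite neq_ltn ltn_predL n_gt0 orbT.
apply/subsemigroupP; split; first by apply/set0Pn; exists 1; rewrite !inE prank1.
have small x : x \in ~: J -> x \notin P -> prank x < n.-1.
  rewrite in_setC perm_units_prank inE => xJ xP.
  have := prank_max x; rewrite leq_eqVlt (negPf xP) /=.
  by rewrite -[X in _ < X](prednK n_gt0) ltnS leq_eqVlt (negPf xJ).
move=> x y Jx Jy; rewrite !inE.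
have [Px|/(small x Jx) Px] := boolP (x \in P); last first.
  by rewrite neq_ltn (leq_ltn_trans (prank_mull x y)).
have [Py|/(small y Jy) Py] := boolP (y \in P); last first.
  by rewrite neq_ltn (leq_ltn_trans (prank_mulr x y)).
have := perm_units_mul x y; rewrite Px Py perm_units_prank => /eqP ->.
exact: n1n.
Qed.

Lemma corank1_nonempty : 1 < n -> exists x, x \in J.
Proof.
move=> n_gt1; have n_gt0 := ltnW n_gt1.
by exists (merge_pair (Ordinal n_gt0) (Ordinal n_gt1)); rewrite inE prank_merge.
Qed.

Lemma maximal_corank1 : 1 < n -> maximal_subsemigroup (~: J).
Proof.
move=> n_gt1; have n_gt0 := ltnW n_gt1.
have [x Jx] := corank1_nonempty n_gt1.
apply/maximal_subsemigroupP; split; first exact: subsemigroup_corank1.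
  by apply/eqP=> /setP/(_ x); rewrite in_setC Jx inE.
move=> N sN JN; have [NJ|] := boolP (N \subset ~: J).
  by left; apply/eqP; rewrite eqEsubset NJ.
case/subsetPn=> y Ny; rewrite in_setC negbK => Jy; right.
apply: (generation n_gt0 sN _ Jy Ny); apply: subset_trans JN.
apply/subsetP=> z; rewrite perm_units_prank in_setC inE => /eqP ->.
by rewrite neq_ltn ltn_predL n_gt0 orbT.
Qed.

(** The non-units of F together with the units of the permutations in A. *)
Definition units_extension (A : {set 'S_n}) : {set ubb n} := ~: P :|: perm_unit @: A.

Lemma mem_units_extension A s : (perm_unit s \in units_extension A) = (s \in A).
Proof. by rewrite inE in_setC mem_perm_unit /= mem_imset //; apply: perm_unit_inj. Qed.

Lemma nonunits_extension A : ~: P \subset units_extension A.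
Proof. exact: subsetUl. Qed.

Lemma sub_units_extension A N :
  ~: P \subset N -> (units_extension A \subset N) = (A \subset perm_unit @^-1: N).
Proof. by move=> PN; rewrite subUset PN sub_imset_pre. Qed.

Lemma units_extension_inj : injective units_extension.
Proof.
by move=> A B AB; apply/setP=> s; rewrite -mem_units_extension AB mem_units_extension.
Qed.

Lemma units_extensionT : units_extension setT = setT.
Proof.
apply/setP=> x; rewrite [RHS]inE inE in_setC -implybE; apply/implyP.
by case/perm_unitsP=> s ->; rewrite imset_f.
Qed.

Lemma units_extensionK N : ~: P \subset N -> units_extension (perm_unit @^-1: N) = N.
Proof.
move=> /subsetP PN; apply/setP=> x.
have [/perm_unitsP[s ->]|Px] := boolP (x \in P).
  by rewrite mem_units_extension inE.
by rewrite [LHS]inE in_setC Px /= PN // in_setC.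
Qed.

(** Inverses are automatic, the group being finite. *)
Lemma group_set_units N :
  subsemigroup N -> 1 \in N -> group_set (perm_unit @^-1: N).
Proof.
case/subsemigroupP=> _ NN N1; apply/group_setP; split=> [|s t].
  by rewrite inE perm_unit1.
by rewrite !inE perm_unitM => /NN; apply.
Qed.

Lemma subsemigroup_extension G : subsemigroup (units_extension G).
Proof.
apply/subsemigroupP; split.
  by apply/set0Pn; exists (perm_unit 1); rewrite mem_units_extension group1.
move=> x y Gx Gy; have [|Pxy] := boolP (x * y \in P); last first.
  by apply: (subsetP (nonunits_extension G)); rewrite in_setC.
rewrite perm_units_mul => /andP[/perm_unitsP[s xs] /perm_unitsP[t yt]].
move: Gx Gy; rewrite xs yt -perm_unitM !mem_units_extension.
exact: groupM.
Qed.

Lemma maximal_extension G :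
  maximal G [set: 'S_n] -> maximal_subsemigroup (units_extension G).
Proof.
case/maxgroupP; rewrite properT => GT maxG; apply/maximal_subsemigroupP; split.
- exact: subsemigroup_extension.
- by rewrite -units_extensionT (inj_eq units_extension_inj).
move=> N sN GN; have PN := subset_trans (nonunits_extension G) GN.
rewrite (sub_units_extension _ PN) in GN.
have N1 : 1 \in N by move/subsetP/(_ 1 (group1 G)): GN; rewrite inE perm_unit1.
pose H := Group (group_set_units sN N1).
rewrite -(units_extensionK PN) -[_ @^-1: _]/(H : {set _}).
have [HT|HT] := eqVneq (H : {set _}) setT.
  by right; rewrite HT units_extensionT.
by left; rewrite (maxG H) // properT.
Qed.

Lemma maximal_subsemigroup_cases M : 1 < n -> maximal_subsemigroup M ->
  (exists2 G : {group 'S_n}, maximal G [set: 'S_n] & M = units_extension G) \/ M = ~: J.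
Proof.
move=> n_gt1 /maximal_subsemigroupP[sM MT maxM]; have n_gt0 := ltnW n_gt1.
have [PM|PM] := boolP (P \subset M).
  right; have MJ : M \subset ~: J.
    apply/subsetP=> x Mx; rewrite in_setC; apply: contraNN MT => Jx.
    exact/eqP/(generation n_gt0 sM PM Jx Mx).
  have [//|JT] := maxM _ (subsemigroup_corank1 n_gt0) MJ.
  have [x] := corank1_nonempty n_gt1.
  by have := in_setT x; rewrite -JT in_setC => /negPf ->.
left; have [_ MM] := subsemigroupP _ sM.
have sPM : subsemigroup (~: P :|: M).
  apply/subsemigroupP; split.
    by case/subsemigroupP: sM => /set0Pn[x Mx] _; apply/set0Pn; exists x; rewrite inE Mx orbT.
  move=> x y; rewrite 3!in_setU !in_setC perm_units_mul.
  by case: (x \in P) => //=; case: (y \in P) => //=; apply: MM.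
have PcM : ~: P \subset M.
  have [<-|PT] := maxM _ sPM (subsetUr _ _); first exact: subsetUl.
  case/negP: PM; apply/subsetP=> x Px.
  by have := in_setT x; rewrite -PT inE in_setC Px.
(* Otherwise 1 |: M is the whole monoid by maximality, so M contains a
   transposition, and hence its square. *)
have M1 : 1 \in M.
  have s1M : subsemigroup ((1 : ubb n) |: M).
    apply/subsemigroupP; split; first by apply/set0Pn; exists 1; rewrite setU11.
    move=> x y /setU1P[->|Mx]; first by rewrite mul1g.
    case/setU1P=> [->|My]; first by rewrite mulg1 setU1r.
    by rewrite setU1r // MM.
  have [<-|MT1] := maxM _ s1M (subsetUr _ _); first exact: setU11.
  pose t := tperm (Ordinal n_gt0) (Ordinal n_gt1).
  have Mt : perm_unit t \in M.
    have := in_setT (perm_unit t); rewrite -MT1 => /setU1P[t1|//].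
    have /perm_unit_inj/permP/(_ (Ordinal n_gt0)) : perm_unit t = perm_unit 1.
      by rewrite t1 perm_unit1.
    by rewrite tpermL perm1 => /(congr1 val).
  by rewrite -(perm_unit1 n) -(tperm2 (Ordinal n_gt0) (Ordinal n_gt1)) perm_unitM MM.
pose G := Group (group_set_units sM M1).
have GM : units_extension G = M := units_extensionK PcM.
exists G => //; apply/maxgroupP; rewrite properT; split=> [|H].
  by apply: contraNneq MT => GT; rewrite -GM GT units_extensionT.
rewrite properT => HT GH.
have [|HM|HM] := maxM _ (subsemigroup_extension H).
- by rewrite -GM sub_units_extension ?nonunits_extension //;
    apply/subsetP=> s /(subsetP GH) Hs; rewrite inE mem_units_extension.
- by apply: units_extension_inj; rewrite HM GM.
- by case/eqP: HT; apply: units_extension_inj; rewrite HM units_extensionT.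
Qed.

Lemma maximal_subsemigroup_iff M : 1 < n ->
  maximal_subsemigroup M <->
  (exists2 G : {group 'S_n}, maximal G [set: 'S_n] & M = units_extension G) \/ M = ~: J.
Proof.
move=> n_gt1; split=> [|[[G maxG ->]|->]]; first exact: maximal_subsemigroup_cases.
  exact: maximal_extension.
exact: maximal_corank1.
Qed.

Lemma perm_units_imset : P = perm_unit @: [set: 'S_n].
Proof.
apply/setP=> x; apply/perm_unitsP/imsetP => [[s ->]|[s _ ->]]; exists s => //.
Qed.

Lemma subgroup_of_unitsP (U : {set ubb n}) :
  reflect (exists G : {group 'S_n}, U = perm_unit @: G) (subgroup_of_units U).
Proof.
apply: (iffP and4P) => [[UP U1 UU _]|[G ->]].
  have sU : subsemigroup U by rewrite /subsemigroup UU andbT; apply/set0Pn; exists 1.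
  exists (Group (group_set_units sU U1)) => /=.
  apply/setP=> x; apply/idP/imsetP => [Ux|[s]]; last by rewrite inE => ? ->.
  by have /perm_unitsP[s xs] := subsetP UP x Ux; exists s; rewrite // inE -xs.
split; first by rewrite perm_units_imset imsetS ?subsetT.
- by rewrite -(perm_unit1 n) imset_f.
- apply/forall_inP=> _ /imsetP[s Gs ->]; apply/forall_inP=> _ /imsetP[t Gt ->].
  by rewrite -perm_unitM imset_f // groupM.
apply/forall_inP=> _ /imsetP[s Gs ->]; apply/existsP; exists (perm_unit s^-1).
by rewrite imset_f ?groupV //= perm_unitKV perm_unitVK eqxx.
Qed.

Lemma perm_unit_imset_sub (A B : {set 'S_n}) :
  (perm_unit @: A \subset perm_unit @: B) = (A \subset B).
Proof.
apply/idP/idP => [/subsetP AB|]; last exact: imsetS.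
apply/subsetP=> s As; have := AB _ (imset_f _ As).
by rewrite mem_imset //; apply: perm_unit_inj.
Qed.

Lemma maximal_subgroup_of_unitsP (U : {set ubb n}) :
  reflect (exists2 G : {group 'S_n}, maximal G [set: 'S_n] & U = perm_unit @: G)
          (maximal_subgroup_of_units U).
Proof.
have properE (A B : {set 'S_n}) : (perm_unit @: A \proper perm_unit @: B) = (A \proper B).
  by rewrite /proper !perm_unit_imset_sub.
apply: (iffP maxsetP) => [[/andP[/subgroup_of_unitsP[G ->]]]|[G /maxgroupP[GT maxG] ->]].
  rewrite perm_units_imset properE => GT maxG; exists G => //.
  apply/maxgroupP; split=> // H HT GH.
  apply: (imset_inj (@perm_unit_inj n)); apply: maxG; last exact: imsetS.
  by rewrite properE HT andbT; apply/subgroup_of_unitsP; exists H.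
split.
  by rewrite perm_units_imset properE GT andbT; apply/subgroup_of_unitsP; exists G.
move=> V /andP[/subgroup_of_unitsP[H ->]].
rewrite perm_units_imset properE perm_unit_imset_sub => HT GH.
by rewrite (maxG H).
Qed.

Lemma card_maximal_subsemigroups : 1 < n ->
  #|[set M : {set ubb n} | maximal_subsemigroup M]|
    = #|[set U : {group 'S_n} | maximal U [set: 'S_n]]|.+1.
Proof.
move=> n_gt1; have n_gt0 := ltnW n_gt1.
pose maxS := [set U : {group 'S_n} | maximal U [set: 'S_n]].
have -> : [set M : {set ubb n} | maximal_subsemigroup M]
    = ~: J |: [set units_extension U | U : {group 'S_n} in maxS].
  apply/setP=> M; rewrite inE; apply/idP/setU1P.
    case/(maximal_subsemigroup_cases n_gt1) => [[G maxG ->]|->]; last by left.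
    by right; apply: imset_f; rewrite inE.
  case=> [->|/imsetP[G]]; first exact: maximal_corank1.
  by rewrite inE => maxG ->; apply: maximal_extension.
rewrite cardsU1 card_imset; last by move=> G H /units_extension_inj/val_inj.
suff -> : ~: J \notin [set units_extension U | U : {group 'S_n} in maxS] by [].
apply/imsetP=> -[G]; rewrite inE => /maxgroupP[+ _] JG; rewrite properT => /eqP[].
apply/setP=> s; rewrite inE -mem_units_extension -JG !inE prank_perm.
by rewrite neq_ltn ltn_predL n_gt0 orbT.
Qed.


(** * Green's relations and types *)

Lemma ideal_perm_conj s t x :
  ideal (perm_unit s * x * perm_unit t) = ideal x.
Proof.
apply/setP=> z; apply/imset2P/imset2P => -[a b _ _ ->].
  by exists (a * perm_unit s) (perm_unit t * b); rewrite // !mulgA.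
exists (a * perm_unit s^-1) (perm_unit t^-1 * b); rewrite // !mulgA.
by rewrite -(mulgA _ (perm_unit s^-1)) perm_unitVK mulg1
           -(mulgA _ (perm_unit t) (perm_unit t^-1)) perm_unitKV mulg1.
Qed.

Lemma prank_ideal x y : ideal x = ideal y -> prank x = prank y.
Proof.
have le a b : ideal a = ideal b -> prank a <= prank b.
  move=> ab; have : a \in ideal b.
    by rewrite -ab; apply/imset2P; exists 1 1; rewrite // mul1g mulg1.
  case/imset2P=> s t _ _ {1}->.
  exact: leq_trans (prank_mull _ _) (prank_mulr _ _).
by move=> xy; apply/eqP; rewrite eqn_leq !le.
Qed.

(** The rank is constant on J-classes, so a rank at which P acts transitively
    by multiplication on both sides is a single J-class. *)
Lemma Jclass_prank r :
    (exists x, prank x = r) ->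
    (forall x y, prank x = r -> prank y = r ->
       exists s t, y = perm_unit s * x * perm_unit t) ->
  [set x : ubb n | prank x == r] \in Jclasses n.
Proof.
case=> x xr tr; apply/imsetP; exists x => //.
apply/setP=> y; rewrite !inE /= /greenJ; apply/eqP/eqP => [yr|/prank_ideal <- //].
by have [s [t ->]] := tr x y xr yr; rewrite ideal_perm_conj.
Qed.

Lemma units_prank : P = [set x : ubb n | prank x == n].
Proof. by apply/setP=> x; rewrite perm_units_prank inE. Qed.

Lemma units_Jclass : P \in Jclasses n.
Proof.
rewrite units_prank; apply: Jclass_prank => [|x y]; first by exists 1; rewrite prank1.
move=> /prank_full[s ->] /prank_full[t ->]; exists t, s^-1.
by rewrite -mulgA perm_unitKV mulg1.
Qed.

Lemma corank1_Jclass : 1 < n -> J \in Jclasses n.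
Proof.
move=> n_gt1; apply: Jclass_prank.
  by have [x] := corank1_nonempty n_gt1; rewrite inE => /eqP; exists x.
move=> x y xJ yJ; apply: prank_pred_transitive; rewrite ?inE ?xJ ?yJ //.
exact: ltnW.
Qed.

(** Each element has the form s e with s a unit and e an idempotent, and
    s e s^-1 s e = s e; so every set of elements is regular. *)
Lemma regular_class_all (K : {set ubb n}) : regular_class K.
Proof.
apply/forall_inP=> x _; have [s ->] := ubb_factorization x.
apply/existsP; exists (perm_unit s^-1).
by rewrite -(mulgA _ (perm_unit s^-1)) (mulgA (perm_unit s^-1)) perm_unitVK mul1g
   -mulgA idem_idem.
Qed.

(** A unit generates the whole monoid as a left and as a right ideal. *)
Lemma greenH_units x y : x \in P -> y \in P -> greenH x y.
Proof.
have L s : left_ideal (perm_unit s) = setT.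
  apply/setP=> z; rewrite [RHS]inE; apply/imsetP; exists (z * perm_unit s^-1) => //.
  by rewrite -mulgA perm_unitVK mulg1.
have R s : right_ideal (perm_unit s) = setT.
  apply/setP=> z; rewrite [RHS]inE; apply/imsetP; exists (perm_unit s^-1 * z) => //.
  by rewrite mulgA perm_unitKV mul1g.
by move=> /perm_unitsP[s ->] /perm_unitsP[t ->]; rewrite /greenH /greenL /greenR !L !R !eqxx.
Qed.

Lemma type_M5_extension G :
  maximal G [set: 'S_n] -> type_M5 (units_extension G).
Proof.
move=> maxG; apply/existsP; exists P; rewrite regular_class_all /=.
apply/andP; split.
  apply/and3P; split; [exact: maximal_extension | exact: units_Jclass |].
  by rewrite -setCS setCK nonunits_extension.
apply/forall_inP=> K /imsetP[x _ ->]; apply/implyP=> /subsetP KP.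
have Px : x \in P by apply: KP; rewrite inE in_setT /= /greenH /greenL /greenR !eqxx.
apply/set0Pn; exists (perm_unit 1).
by rewrite !in_setI mem_units_extension group1 mem_perm_unit inE in_setT /=
   greenH_units ?mem_perm_unit.
Qed.

Lemma type_M1_corank1 : 1 < n -> type_M1 (~: J).
Proof.
move=> n_gt1; apply/existsP; exists J; rewrite regular_class_all /arises_from.
by rewrite maximal_corank1 // corank1_Jclass // setCK subxx setIC setICr eqxx.
Qed.

End Classification.

Theorem theorem4p5 (n : nat) (hn : (2 <= n)%N) :
  [/\ forall M : {set ubb n},
        maximal_subsemigroup M <->
        (exists U : {set ubb n},
           maximal_subgroup_of_units U /\ M = ~: perm_units n :|: U)
        \/ M = ~: [set x : ubb n | prank x == n.-1],
      forall U : {set ubb n},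
        maximal_subgroup_of_units U -> type_M5 (~: perm_units n :|: U),
      type_M1 (~: [set x : ubb n | prank x == n.-1])
    & #|[set M : {set ubb n} | maximal_subsemigroup M]|
      = #|[set U : {group 'S_n} | maximal U [set: 'S_n]]|.+1 ].
Proof.
split.
- move=> M; apply: (iff_trans (maximal_subsemigroup_iff M hn)).
  split=> -[[U]|->]; try by right.
    move=> maxU ->; left; exists (@perm_unit n @: U); split=> //.
    by apply/maximal_subgroup_of_unitsP; exists U.
  by case=> /maximal_subgroup_of_unitsP[G maxG ->] ->; left; exists G.
- by move=> _ /maximal_subgroup_of_unitsP[G maxG ->]; apply: type_M5_extension.
- exact: type_M1_corank1.
- exact: card_maximal_subsemigroups.
Qed.
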